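(* (Another Rogers type formula for $\psi_n^{(\mathbf a,\mathbf b)}(x,y|q)$.) Let $|q|<1$. It is asserted that $$\sum_{n=0}^\infty\sum_{m=0}^\infty(-1)^{n}q^{\binom n2}\,\psi_{n+m}^{(\mathbf a,\mathbf b)}(x,y|q)\,\frac{t^n}{(q;q)_n}\,\frac{s^m}{(q;q)_m}=\frac{(yt;q)_\infty}{(ys;q)_\infty}\;{}_{r+2}\Phi_{r+1}\!\left[\begin{matrix}a_1,a_2,\dots,a_{r+1},\,t/s\\ b_1,b_2,\dots,b_r,\,q/(ys)\end{matrix};q;\frac{xq}{y}\right]\qquad(|ys|<1).$$
   Context: Notation: $(a;q)_0=1$, $(a;q)_n=\prod_{k=0}^{n-1}(1-aq^k)$, $(a;q)_\infty=\prod_{k=0}^\infty(1-aq^k)$, $(c_1,\dots,c_m;q)_n=(c_1;q)_n\cdots(c_m;q)_n$, and $\left[{n\atop k}\right]_q=\frac{(q;q)_n}{(q;q)_k(q;q)_{n-k}}$ is the $q$-binomial coefficient. Basic hypergeometric series: ${}_{r+2}\Phi_{r+1}\!\left[\begin{matrix}\alpha_1,\dots,\alpha_{r+2}\\ \beta_1,\dots,\beta_{r+1}\end{matrix};q;z\right]=\sum_{k\ge0}\frac{(\alpha_1,\dots,\alpha_{r+2};q)_k}{(\beta_1,\dots,\beta_{r+1};q)_k}\frac{z^k}{(q;q)_k}$. With parameters $\mathbf a=(a_1,\dots,a_{r+1})$ and $\mathbf b=(b_1,\dots,b_r)$, the generalized Al-Salam-Carlitz $q$-polynomials $\psi_n$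 are $$\psi_n^{(\mathbf a,\mathbf b)}(x,y|q)=\sum_{k=0}^n\left[{n\atop k}\right]_q\frac{(a_1,\dots,a_{r+1};q)_k}{(b_1,\dots,b_r;q)_k}\,(-1)^kq^{\binom{k+1}2-nk}\,x^ky^{n-k}.$$
   Formalization: The identity fails for |q|<1, |ys|<1 alone (e.g. r=0, a=(0), x=y=1, t=0); it is proved numerically when the double series with each ψ written out converges absolutely, and for all parameters as an identity of formal power series in s and t. *)

(* Defs.v *)
(* Stdlib reals and Coquelicot's complex numbers *)
From Stdlib Require Export Reals List.
From Coquelicot Require Export Coquelicot.

Open Scope C_scope.

Fixpoint qpoch (a q : C) (n : nat) : C :=
  match n with
  | O => 1
  | S k => qpoch a q k * (1 - a * q ^ k)
  end.

(* Limits and sums of complex sequences, taken on real and imaginary parts;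
   total operators, meaningful only in the convergent case. *)
Definition CLim_seq (u : nat -> C) : C :=
  (real (Lim_seq (fun n => Re (u n))), real (Lim_seq (fun n => Im (u n)))).

Definition CSeries (u : nat -> C) : C :=
  (Series (fun n => Re (u n)), Series (fun n => Im (u n))).

(* The partial products converge whenever [Cmod q < 1]. *)
Definition qpoch_inf (a q : C) : C := CLim_seq (qpoch a q).

Definition qpochs (l : list C) (q : C) (n : nat) : C :=
  fold_right (fun c p => qpoch c q n * p) 1 l.

Definition qbinom (q : C) (n k : nat) : C :=
  qpoch q q n / (qpoch q q k * qpoch q q (n - k)).

Definition Phi_term (alpha beta : list C) (q z : C) (k : nat) : C :=
  qpochs alpha q k / qpochs beta q k * (z ^ k / qpoch q q k).

(* There is one more upper than lower parameter in all uses below, so the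
   usual extra factor ((-1)^k q^(k(k-1)/2))^(1 + #beta - #alpha) is 1. *)
Definition Phi (alpha beta : list C) (q z : C) : C :=
  CSeries (Phi_term alpha beta q z).

(* q^(binom(k+1,2) - n k) is written as a quotient, its exponent being
   possibly negative. *)
Definition psi_term (a b : list C) (q x y : C) (n k : nat) : C :=
  qbinom q n k * (qpochs a q k / qpochs b q k) * (- (1)) ^ k
  * (q ^ (k * (k + 1) / 2)%nat / q ^ (n * k)%nat) * x ^ k * y ^ (n - k)%nat.

Definition psi (a b : list C) (q x y : C) (n : nat) : C :=
  sum_n (psi_term a b q x y n) n.

Definition rogers_coef (q s t : C) (n m : nat) : C :=
  (- (1)) ^ n * q ^ (n * (n - 1) / 2)%nat
  * (t ^ n / qpoch q q n) * (s ^ m / qpoch q q m).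

Definition rogers_term (a b : list C) (q x y s t : C) (n m : nat) : C :=
  rogers_coef q s t n m * psi a b q x y (n + m).

(* The iterated series sum_n sum_m u n m converges, with sum l. *)
Definition is_series2 (u : nat -> nat -> C) (l : C) : Prop :=
  exists v : nat -> C, (forall n, is_series (u n) (v n)) /\ is_series v l.

(* Absolute convergence of the double series once each polynomial
   psi_(n+m) is written out as a sum over k <= n + m. Absolute convergence in
   (n, m) alone does not validate the interchange of summations: for a = (0),
   b = (), x = y one has psi_0 = 1 and psi_n = 0 for n > 0, so that the double
   series is the single term 1, which is not the value of the product side. *)
Definition rogers_abs_cv (a b : list C) (q x y s t : C) : Prop :=
  exists M : R, forall N : nat,
    (sum_n (fun n => sum_n (fun m => sum_n (fun k =>
       Cmod (rogers_coef q s t n m * psi_term a b q x y (n + m) k))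
       (n + m)) N) N <= M)%R.

(* Part of the double series, seen as a power series in s and t, of total
   degree at most K. *)
Definition rogers_trunc (a b : list C) (q x y s t : C) (K : nat) : C :=
  sum_n (fun N => sum_n (fun n => rogers_term a b q x y s t n (N - n)) N) K.

(* Since (t/s;q)_k / (q/(ys);q)_k is the product over i < k of
   y (s - t q^i) / (y s - q^(i+1)), the k-th term is analytic in (s, t) near
   (0, 0) and divisible there by no less than k-th powers: only the terms
   k <= K matter modulo total degree > K. *)
Definition product_side_trunc (a b : list C) (q x y s t : C) (K : nat) : C :=
  qpoch_inf (y * t) q / qpoch_inf (y * s) q
  * sum_n (Phi_term (a ++ t / s :: nil) (b ++ q / (y * s) :: nil)
             q (x * q / y)) K.

(* Equality of the two sides as formal power series in s and t: the
   truncations agree modulo terms of total degree > K, for every K. *)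
Definition rogers_formal_eq (a b : list C) (q x y : C) : Prop :=
  forall K : nat, exists (M delta : R), (0 < delta)%R /\
    forall s t : C, s <> 0 -> (Cmod s < delta)%R -> (Cmod t < delta)%R ->
      (Cmod (rogers_trunc a b q x y s t K - product_side_trunc a b q x y s t K)
       <= M * (Cmod s + Cmod t) ^ (S K))%R.

(* Main.v *)
Require Import Defs.
From Stdlib Require Import Lra Lia.

(** Expand psi over its index [k]. The k-th term of [psi_N] is a constant
    [psi_coef k] times [y^N weight q k N], where [weight q k N], the product of
    the factors [q^(-N) - q^(-i)] for [i < k], is a polynomial in [q^(-N)] that
    vanishes for [N < k]. For a fixed [k] the double series is thus the
    double series with weights [y^(n+m) weight q k (n+m)], and expanding the
    weight into geometric sequences [z^(n+m)] reduces it to products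
    [(z t;q)_oo / (z s;q)_oo] of Euler's two series. The combination of these
    products collapses: by induction on [k], using one factor of the weight at
    a time ([weighted_sum], [weighted_value_S]), the sum is a closed form which,
    after reversing the [k] extra factors of [(y s / q^k;q)_oo], is
    [(yt;q)_oo / (ys;q)_oo] times the k-th term of the hypergeometric series
    ([psi_coef_weighted_value]). This holds where [|y s| < |q|^k].

    For the convergent statement, absolute convergence of the expanded series
    forces [psi_coef k = 0] whenever [|y s| >= |q|^k] ([abs_cv_psi_coef]). So
    only finitely many [k] contribute, each within the domain of the closed
    form, and the iterated sums are added up ([rogers_analytic]).

    For the formal statement, summing the same weights over total degrees
    [N = n + m] gives, by the finite q-binomial theorem
    ([rogers_coef_antidiagonal]), a series whose N-th term is homogeneous of
    degree [N] in [(s, t)] and geometrically bounded. Its truncation at degree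
    [K] therefore differs from the closed form by [O((|s| + |t|)^(K+1))]
    ([weighted_sum_remainder]); adding over [k <= K] gives the claim.

    The q-binomial theorem [q_binomial], which contains both series of Euler,
    follows from its functional equation under [(s, t) -> (q s, q t)]. The same
    equation yields the convergence of the infinite products and the
    non-vanishing of [(s;q)_oo] for [|s| < 1]. *)

(* The equalities produced by the lemmas on series are typed in a
   carrier convertible to [C], in a form that [ring] does not recognize. *)
Ltac eqC := match goal with |- @eq _ ?a ?b => change (@eq C a b) end.

(** * Limits and series of complex numbers *)

(** Convergence read off the real sequence of distances, so that estimates are
    made with the real limit lemmas; [filterlim_Clim] relates it to the filter
    of neighbourhoods used by [is_series]. *)
Definition Clim (u : nat -> C) (l : C) : Prop :=
  is_lim_seq (fun n => Cmod (u n - l)) 0.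

Lemma filterlim_Clim (u : nat -> C) (l : C) :
  filterlim u eventually (locally (l : C_NormedModule)) <-> Clim u l.
Proof.
  unfold Clim. rewrite <- is_lim_seq_spec. split; intros H.
  - intros eps.
    generalize (proj1 (filterlim_locally_ball_norm (U := C_NormedModule) u l) H eps).
    apply filter_imp. intros n Hn. rewrite Rminus_0_r, Rabs_right.
    + exact Hn.
    + apply Rle_ge, Cmod_ge_0.
  - apply (filterlim_locally_ball_norm (U := C_NormedModule)). intros eps.
    generalize (H eps). apply filter_imp. intros n Hn.
    rewrite Rminus_0_r, Rabs_right in Hn.
    + exact Hn.
    + apply Rle_ge, Cmod_ge_0.
Qed.

Lemma is_series_Clim (u : nat -> C) (l : C) :
  is_series u l <-> Clim (sum_n u) l.
Proof. apply filterlim_Clim. Qed.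

Lemma Clim_dominated (u : nat -> C) (l : C) (w : nat -> R) :
  eventually (fun n => (Cmod (u n - l)%C <= w n)%R) -> is_lim_seq w 0 -> Clim u l.
Proof.
  intros Hle Hw. apply (is_lim_seq_le_le_loc (fun _ => 0%R) _ w).
  - revert Hle. apply filter_imp. intros n Hn. split; [apply Cmod_ge_0 | exact Hn].
  - apply is_lim_seq_const.
  - exact Hw.
Qed.

Lemma Clim_ext (u v : nat -> C) (l : C) :
  (forall n, u n = v n) -> Clim u l -> Clim v l.
Proof.
  intros H. apply is_lim_seq_ext. intros n. now rewrite H.
Qed.

Lemma im_le_Cmod (z : C) : (Rabs (Im z) <= Cmod z)%R.
Proof.
  generalize (Rmax_Cmod z). intros H.
  eapply Rle_trans; [apply Rmax_r | exact H].
Qed.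

Lemma CLim_seq_unique (u : nat -> C) (l : C) : Clim u l -> CLim_seq u = l.
Proof.
  intros H.
  assert (HR : forall p : C -> R,
             (forall z w, p (z - w) = (p z - p w)%R) ->
             (forall z, Rabs (p z) <= Cmod z)%R ->
             real (Lim_seq (fun n => p (u n))) = p l).
  { intros p Hp Hle.
    rewrite (is_lim_seq_unique _ (Finite (p l))); [reflexivity|].
    apply is_lim_seq_ext with (fun n => (p (u n - l)%C + p l)%R).
    { intros n. rewrite Hp. ring. }
    replace (Finite (p l)) with (Finite (0 + p l)) by (f_equal; ring).
    apply is_lim_seq_plus'; [|apply is_lim_seq_const].
    apply is_lim_seq_abs_0.
    apply (is_lim_seq_le_le (fun _ => 0%R) _ (fun n => Cmod (u n - l))).
    - intros n. split; [apply Rabs_pos | apply Hle].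
    - apply is_lim_seq_const.
    - exact H. }
  unfold CLim_seq.
  rewrite (HR Re), (HR Im).
  - destruct l; reflexivity.
  - intros; destruct z, w; simpl; ring.
  - apply im_le_Cmod.
  - intros; destruct z, w; simpl; ring.
  - apply re_le_Cmod.
Qed.

Lemma CSeries_unique (u : nat -> C) (l : C) : is_series u l -> CSeries u = l.
Proof.
  intros H. apply is_series_Clim, CLim_seq_unique in H. rewrite <- H.
  unfold CSeries, CLim_seq, Series.
  f_equal; f_equal; apply Lim_seq_ext; intros n;
    (induction n as [|n IH]; [now rewrite !sum_O | rewrite !sum_Sn, IH; reflexivity]).
Qed.

Lemma Clim_unique (u : nat -> C) (l l' : C) : Clim u l -> Clim u l' -> l = l'.
Proof.
  intros H H'. rewrite <- (CLim_seq_unique u l H). now apply CLim_seq_unique.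
Qed.

Lemma Clim_mult (u v : nat -> C) (l l' : C) :
  Clim u l -> Clim v l' -> Clim (fun n => u n * v n) (l * l').
Proof.
  intros H H'.
  apply Clim_dominated with
    (fun n => Cmod (u n - l)%C * Cmod (v n - l')%C
              + (Cmod l * Cmod (v n - l')%C + Cmod l' * Cmod (u n - l)%C))%R.
  - exists 0%nat. intros n _. rewrite <- !Cmod_mult.
    replace (u n * v n - l * l')%C
      with ((u n - l) * (v n - l') + (l * (v n - l') + l' * (u n - l)))%C by ring.
    eapply Rle_trans; [apply Cmod_triangle|].
    apply Rplus_le_compat_l, Cmod_triangle.
  - replace (Finite 0) with (Finite (0 * 0 + (Cmod l * 0 + Cmod l' * 0)))
      by (f_equal; ring).
    repeat apply is_lim_seq_plus'; apply is_lim_seq_mult';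
      first [exact H | exact H' | apply is_lim_seq_const].
Qed.

Lemma Clim_const (c : C) : Clim (fun _ => c) c.
Proof.
  apply Clim_dominated with (fun _ => 0%R); [|apply is_lim_seq_const].
  exists 0%nat. intros n _. replace (c - c) with (RtoC 0) by ring.
  rewrite Cmod_0. lra.
Qed.

Lemma Cmod_sum_n_le (u : nat -> C) (n : nat) :
  (Cmod (sum_n u n) <= sum_n (fun k => Cmod (u k)) n)%R.
Proof. apply (norm_sum_n_m (V := C_NormedModule)). Qed.

Lemma Clim_bound (u : nat -> C) (l : C) (B : R) :
  Clim u l -> (forall n, Cmod (u n) <= B)%R -> (Cmod l <= B)%R.
Proof.
  intros H HB.
  apply (is_lim_seq_le (fun _ => Cmod l) (fun n => Cmod (u n - l)%C + B)%R
           (Cmod l) B).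
  - intros n. replace l with (- (u n - l) + u n) at 1 by ring.
    eapply Rle_trans; [apply Cmod_triangle|]. rewrite Cmod_opp.
    apply Rplus_le_compat_l, HB.
  - apply is_lim_seq_const.
  - replace (Finite B) with (Finite (0 + B)) by (f_equal; ring).
    apply is_lim_seq_plus'; [exact H | apply is_lim_seq_const].
Qed.

Lemma Cmod_series_le (u : nat -> C) (w : nat -> R) (l : C) (W : R) :
  (forall n, Cmod (u n) <= w n)%R -> is_series u l -> is_series w W ->
  (Cmod l <= W)%R.
Proof.
  intros Hle Hu Hw. apply is_series_Clim in Hu.
  apply (Clim_bound _ _ _ Hu). intros n.
  eapply Rle_trans; [apply Cmod_sum_n_le|].
  eapply Rle_trans; [apply sum_n_m_le; intros k; apply Hle|].
  rewrite <- (is_series_unique _ _ Hw).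
  assert (Hpos : forall k, (0 <= w k)%R).
  { intros k. eapply Rle_trans; [apply Cmod_ge_0|apply Hle]. }
  apply (is_lim_seq_incr_compare (sum_n w)).
  - apply Series_correct. now exists W.
  - intros k. rewrite sum_Sn. generalize (Hpos (S k)). unfold plus; simpl. lra.
Qed.

Lemma ex_series_Cmod (u : nat -> C) (w : nat -> R) :
  (forall n, Cmod (u n) <= w n)%R -> ex_series w -> ex_series u.
Proof. apply (ex_series_le (V := C_CompleteNormedModule)). Qed.

(** Unlike d'Alembert's criterion on the quotients, this allows terms that
    vanish. *)
Lemma ex_series_ratio (u : nat -> C) (rho : R) (N0 : nat) :
  (0 <= rho < 1)%R ->
  (forall n, (N0 <= n)%nat -> Cmod (u (S n)) <= rho * Cmod (u n))%R ->
  ex_series (fun n => Cmod (u n)).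
Proof.
  intros Hrho H. apply (ex_series_incr_n _ N0).
  apply (ex_series_le (V := R_CompleteNormedModule) _
           (fun k => Cmod (u N0) * rho ^ k)%R).
  - intros k. unfold norm; simpl. unfold abs; simpl.
    rewrite Rabs_right by apply Rle_ge, Cmod_ge_0.
    induction k as [|k IH].
    + rewrite Nat.add_0_r. simpl. lra.
    + rewrite Nat.add_succ_r. eapply Rle_trans; [apply H; lia|].
      simpl. replace (Cmod (u N0) * (rho * rho ^ k))%R
        with (rho * (Cmod (u N0) * rho ^ k))%R by ring.
      apply Rmult_le_compat_l; [lra | exact IH].
  - apply (ex_series_scal_l (V := R_NormedModule)), ex_series_geom.
    rewrite Rabs_right; lra.
Qed.

(** Once [v n] is within 1/2 of 1, [u n] is bounded by [2 |c|], and
    [u n - c = - u n (v n - 1)]. *)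
Lemma Clim_quotient (u v : nat -> C) (c : C) :
  (forall n, u n * v n = c) -> Clim v 1 -> Clim u c.
Proof.
  intros Huv Hv.
  apply Clim_dominated with (fun n => 2 * Cmod c * Cmod (v n - 1)%C)%R.
  - generalize (proj2 (is_lim_seq_spec _ _) Hv (mkposreal (1/2) ltac:(lra))).
    apply filter_imp. simpl. intros n Hn.
    rewrite Rminus_0_r, Rabs_right in Hn by apply Rle_ge, Cmod_ge_0.
    assert (Hun : (Cmod (u n) <= 2 * Cmod c)%R).
    { assert (H1 : (1 <= Cmod (v n - 1)%C + Cmod (v n))%R).
      { replace 1%R with (Cmod (- (v n - 1) + v n)%C) at 1.
        - eapply Rle_trans; [apply Cmod_triangle|]. rewrite Cmod_opp. lra.
        - replace (- (v n - 1) + v n)%C with (RtoC 1) by ring. apply Cmod_1. }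
      rewrite <- (Huv n), Cmod_mult. generalize (Cmod_ge_0 (u n)). nra. }
    replace (u n - c)%C with (- (u n * (v n - 1)))%C by (rewrite <- (Huv n); ring).
    rewrite Cmod_opp, Cmod_mult.
    apply Rmult_le_compat_r; [apply Cmod_ge_0 | exact Hun].
  - replace (Finite 0) with (Rbar_mult (2 * Cmod c)%R 0) by (simpl; f_equal; ring).
    apply is_lim_seq_scal_l, Hv.
Qed.

Lemma CSeries_correct (u : nat -> C) : ex_series u -> is_series u (CSeries u).
Proof. intros [l Hl]. now rewrite (CSeries_unique _ _ Hl). Qed.

(** * The q-binomial theorem *)

Lemma Cmod_pow_lim (q : C) : (Cmod q < 1)%R -> is_lim_seq (fun n => Cmod q ^ n)%R 0.
Proof.
  intros Hq. apply is_lim_seq_geom. rewrite Rabs_right; [exact Hq|].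
  apply Rle_ge, Cmod_ge_0.
Qed.

Lemma Cmod_lt_1_neq (z : C) : (Cmod z < 1)%R -> 1 - z <> 0.
Proof.
  intros Hz H. assert (E : z = 1) by (replace z with (1 - (1 - z)) by ring; rewrite H; ring).
  rewrite E, Cmod_1 in Hz. lra.
Qed.

Lemma Cmod_pow_le_1 (q : C) (n : nat) : (Cmod q < 1)%R -> (Cmod (q ^ n) <= 1)%R.
Proof.
  intros Hq. rewrite Cmod_pow, <- (pow1 n).
  apply pow_incr. split; [apply Cmod_ge_0 | lra].
Qed.

Lemma Cmod_mul_pow_lt_1 (s q : C) (n : nat) :
  (Cmod s < 1)%R -> (Cmod q < 1)%R -> (Cmod (s * q ^ n) < 1)%R.
Proof.
  intros Hs Hq. rewrite Cmod_mult.
  generalize (Cmod_pow_le_1 q n Hq) (Cmod_ge_0 s) (Cmod_ge_0 (q ^ n)). nra.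
Qed.

Lemma qpoch_neq0 (s q : C) (n : nat) :
  (Cmod s < 1)%R -> (Cmod q < 1)%R -> qpoch s q n <> 0.
Proof.
  intros Hs Hq. induction n as [|n IH]; simpl.
  - apply C1_nz.
  - apply Cmult_neq_0; [exact IH|].
    now apply Cmod_lt_1_neq, Cmod_mul_pow_lt_1.
Qed.

(** The Cauchy polynomial [(s - t) (s - t q) ... (s - t q^(n-1))], that is
    [s^n (t/s;q)_n] with the denominator cleared, so that [s = 0] is allowed. *)
Fixpoint cauchy_poly (s t q : C) (n : nat) : C :=
  match n with
  | O => 1
  | S k => cauchy_poly s t q k * (s - t * q ^ k)
  end.

Lemma cauchy_poly_scale (c s t q : C) (n : nat) :
  cauchy_poly (c * s) (c * t) q n = c ^ n * cauchy_poly s t q n.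
Proof. induction n as [|n IH]; simpl; [|rewrite IH]; ring. Qed.

Lemma cauchy_poly_qpoch (s t q : C) (n : nat) :
  s <> 0 -> cauchy_poly s t q n = s ^ n * qpoch (t / s) q n.
Proof.
  intros Hs. induction n as [|n IH]; simpl; [|rewrite IH]; [ring|field; exact Hs].
Qed.

Lemma qpoch_0_l (q : C) (n : nat) : qpoch 0 q n = 1.
Proof. induction n as [|n IH]; simpl; [|rewrite IH]; ring. Qed.

(** The n-th term of the q-binomial series. Its homogeneity of degree [n] in
    [(s, t)] is what lets [s = 0] and [t = 0] give the two series of Euler. *)
Definition qbinom_term (q s t : C) (n : nat) : C := cauchy_poly s t q n / qpoch q q n.

Lemma qbinom_term_S (q s t : C) (n : nat) :
  (Cmod q < 1)%R ->
  (1 - q ^ S n) * qbinom_term q s t (S n) = (s - t * q ^ n) * qbinom_term q s t n.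
Proof.
  intros Hq. unfold qbinom_term. simpl. field. split.
  - now apply qpoch_neq0.
  - now apply Cmod_lt_1_neq, Cmod_mul_pow_lt_1.
Qed.

Lemma qbinom_term_scale (q s t c : C) (n : nat) :
  qbinom_term q (c * s) (c * t) n = c ^ n * qbinom_term q s t n.
Proof. unfold qbinom_term. rewrite cauchy_poly_scale. unfold Cdiv. ring. Qed.

(** The ratio of consecutive terms is [(s - t q^n) / (1 - q^(n+1))], which tends
    to [s]; it is eventually bounded by the midpoint of [|s|] and 1. *)
Lemma ex_series_Cmod_qbinom (q s t : C) :
  (Cmod q < 1)%R -> (Cmod s < 1)%R ->
  ex_series (fun n => Cmod (qbinom_term q s t n)).
Proof.
  intros Hq Hs.
  (* With [|q|^n <= eps] the bound
     [|s| + |t| |q|^n <= (1 + |s|) / 2 (1 - |q|^n)] holds. *)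
  set (eps := ((1 - Cmod s) / 2 / (Cmod t + 1))%R).
  assert (Heps : (0 < eps)%R).
  { unfold eps. generalize (Cmod_ge_0 t). intros. apply Rdiv_lt_0_compat; lra. }
  destruct (proj2 (is_lim_seq_spec _ _) (Cmod_pow_lim q Hq) (mkposreal eps Heps))
    as [N0 HN0].
  apply (ex_series_ratio _ ((1 + Cmod s) / 2) N0).
  { generalize (Cmod_ge_0 s). lra. }
  intros n Hn. specialize (HN0 n Hn). simpl in HN0.
  rewrite Rminus_0_r, Rabs_right in HN0
    by (apply Rle_ge, pow_le, Cmod_ge_0).
  set (Q := (Cmod q ^ n)%R) in *.
  assert (HQ0 : (0 <= Q)%R) by apply pow_le, Cmod_ge_0.
  assert (HQ : (Q * (Cmod t + 1) <= (1 - Cmod s) / 2)%R).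
  { replace ((1 - Cmod s) / 2)%R with (eps * (Cmod t + 1))%R.
    - apply Rmult_le_compat_r; [generalize (Cmod_ge_0 t); lra | lra].
    - unfold eps. field. generalize (Cmod_ge_0 t). lra. }
  assert (Hd : (1 - Q <= Cmod (1 - q ^ S n)%C)%R).
  { assert (HqS : (Cmod (q ^ S n) <= Q)%R).
    { rewrite Cmod_pow. simpl. fold Q. generalize (Cmod_ge_0 q). nra. }
    assert (H1 : (1 <= Cmod (1 - q ^ S n)%C + Cmod (q ^ S n))%R).
    { replace 1%R with (Cmod ((1 - q ^ S n) + q ^ S n)%C) at 1.
      - apply Cmod_triangle.
      - replace ((1 - q ^ S n) + q ^ S n)%C with (RtoC 1) by ring. apply Cmod_1. }
    lra. }
  assert (Hn' : (Cmod (s - t * q ^ n)%C <= Cmod s + Cmod t * Q)%R).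
  { eapply Rle_trans; [apply Cmod_triangle|].
    rewrite Cmod_opp, Cmod_mult, Cmod_pow. fold Q. lra. }
  generalize (f_equal Cmod (qbinom_term_S q s t n Hq)). rewrite !Cmod_mult.
  generalize (Cmod_ge_0 (qbinom_term q s t n)) (Cmod_ge_0 (qbinom_term q s t (S n))).
  generalize (Cmod_ge_0 s) (Cmod_ge_0 t).
  revert Hd Hn'.
  generalize (Cmod (1 - q ^ S n)%C) (Cmod (s - t * q ^ n)%C)
    (Cmod (qbinom_term q s t n)) (Cmod (qbinom_term q s t (S n))).
  intros D N u v HD HN Hs0 Ht0 Hu Hv E.
  assert (HDN : (N <= (1 + Cmod s) / 2 * D)%R) by nra.
  assert (HDpos : (0 < D)%R) by nra.
  apply Rmult_le_reg_l with D; [exact HDpos|]. rewrite E.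
  replace (D * ((1 + Cmod s) / 2 * u))%R with (((1 + Cmod s) / 2 * D) * u)%R by ring.
  now apply Rmult_le_compat_r.
Qed.

Lemma ex_series_qbinom (q s t : C) :
  (Cmod q < 1)%R -> (Cmod s < 1)%R -> ex_series (qbinom_term q s t).
Proof.
  intros Hq Hs.
  apply ex_series_Cmod with (fun n => Cmod (qbinom_term q s t n)).
  - intros n. apply Rle_refl.
  - now apply ex_series_Cmod_qbinom.
Qed.

Lemma is_series_C_unique (u : nat -> C) (l l' : C) :
  is_series u l -> is_series u l' -> l = l'.
Proof. intros H H'. apply (Clim_unique (sum_n u)); now apply is_series_Clim. Qed.

(** Multiplying the term of index [n] by [1 - q^n] turns the sum at [(s, t)] into
    its difference with the sum at [(q s, q t)], by homogeneity; it also shifts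
    the index, producing the factor [s - t q^n]. *)
Lemma qbinom_functional (q s t f g : C) :
  (Cmod q < 1)%R ->
  is_series (qbinom_term q s t) f ->
  is_series (qbinom_term q (q * s) (q * t)) g ->
  (1 - s) * f = (1 - t) * g.
Proof.
  intros Hq Hf Hg.
  assert (H1 : is_series (fun n => qbinom_term q s t (S n) - qbinom_term q (q * s) (q * t) (S n))
                 (f - g)).
  { apply (is_series_incr_1 (V := C_NormedModule)
             (fun n => qbinom_term q s t n - qbinom_term q (q * s) (q * t) n)).
    replace (plus _ _) with (plus f (opp g) : C_NormedModule).
    - apply (is_series_minus (V := C_NormedModule)); assumption.
    - unfold qbinom_term. simpl. unfold plus, opp; simpl. field. }
  assert (H2 : is_series (fun n => s * qbinom_term q s t n - t * qbinom_term q (q * s) (q * t) n)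
                 (s * f - t * g)).
  { apply (is_series_minus (V := C_NormedModule));
      apply (is_series_scal_l (V := C_NormedModule)); assumption. }
  assert (E : f - g = s * f - t * g).
  { apply (is_series_C_unique _ _ _ H1).
    apply (is_series_ext (V := C_NormedModule)) with (2 := H2). intros n.
    rewrite !qbinom_term_scale.
    transitivity ((1 - q ^ S n) * qbinom_term q s t (S n)); [|eqC; simpl; ring].
    rewrite qbinom_term_S by exact Hq. eqC; ring. }
  replace ((1 - s) * f) with ((f - g) + g - s * f) by ring. rewrite E. ring.
Qed.

(** By homogeneity every term but the first gains at least a factor [q^n]. *)
Lemma qbinom_sum_tends_1 (q s t : C) :
  (Cmod q < 1)%R -> (Cmod s < 1)%R ->
  Clim (fun n => CSeries (qbinom_term q (q ^ n * s) (q ^ n * t))) 1.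
Proof.
  intros Hq Hs.
  destruct (ex_series_Cmod_qbinom q s t Hq Hs) as [W HW].
  apply Clim_dominated with (fun n => Cmod q ^ n * W)%R.
  - exists 0%nat. intros n _.
    assert (Hns : (Cmod (q ^ n * s) < 1)%R).
    { rewrite Cmult_comm. now apply Cmod_mul_pow_lt_1. }
    apply (Cmod_series_le
             (fun k => match k with O => 0 | S _ => qbinom_term q (q ^ n * s) (q ^ n * t) k end)
             (fun k => Cmod q ^ n * Cmod (qbinom_term q s t k))%R).
    + intros [|k].
      * rewrite Cmod_0. apply Rmult_le_pos; [apply pow_le|]; apply Cmod_ge_0.
      * rewrite qbinom_term_scale, Cmod_mult. apply Rmult_le_compat_r; [apply Cmod_ge_0|].
        rewrite Cpow_S, Cmod_mult, <- Cpow_mult_r, <- Cmod_pow.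
        generalize (Cmod_pow_le_1 q (n * k) Hq) (Cmod_ge_0 (q ^ n)). nra.
    + apply (is_series_decr_1 (V := C_NormedModule)).
      apply (is_series_incr_1 (V := C_NormedModule) (qbinom_term q (q ^ n * s) (q ^ n * t))).
      replace (plus _ _) with (CSeries (qbinom_term q (q ^ n * s) (q ^ n * t)) : C_NormedModule).
      * now apply CSeries_correct, ex_series_qbinom.
      * unfold qbinom_term, plus, opp; simpl. field.
    + apply (is_series_scal_l (V := R_NormedModule)). exact HW.
  - replace (Finite 0) with (Finite (0 * W)) by (f_equal; ring).
    apply is_lim_seq_mult'; [now apply Cmod_pow_lim | apply is_lim_seq_const].
Qed.

Lemma qbinom_functional_iter (q s t : C) (n : nat) :
  (Cmod q < 1)%R -> (Cmod s < 1)%R ->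
  qpoch t q n * CSeries (qbinom_term q (q ^ n * s) (q ^ n * t))
  = qpoch s q n * CSeries (qbinom_term q s t).
Proof.
  intros Hq Hs. induction n as [|n IH].
  - simpl. now rewrite !Cmult_1_l.
  - simpl.
    transitivity ((1 - s * q ^ n) * (qpoch s q n * CSeries (qbinom_term q s t)));
      [rewrite <- IH | ring].
    assert (Hns : forall n, (Cmod (q ^ n * s) < 1)%R).
    { intros k. rewrite Cmult_comm. now apply Cmod_mul_pow_lt_1. }
    generalize (qbinom_functional q (q ^ n * s) (q ^ n * t) _ _ Hq
                  (CSeries_correct _ (ex_series_qbinom q _ (q ^ n * t) Hq (Hns n)))
                  (CSeries_correct _ (ex_series_qbinom q (q * (q ^ n * s)) (q * (q ^ n * t)) Hq
                     ltac:(rewrite Cmult_assoc; exact (Hns (S n)))))).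
    rewrite !Cmult_assoc. intros E.
    replace (1 - s * q ^ n) with (1 - q ^ n * s) by ring.
    transitivity (qpoch t q n
      * ((1 - q ^ n * t) * CSeries (qbinom_term q (q * q ^ n * s) (q * q ^ n * t)))).
    + ring.
    + rewrite <- E. ring.
Qed.

(** At [s = 0] the iterated functional equation reads [(t;q)_n v_n = f], with
    [v_n] tending to 1 and [f] independent of [n]: the infinite product
    converges without any estimate on its factors. *)
Lemma qpoch_tends (q t : C) : (Cmod q < 1)%R -> Clim (qpoch t q) (qpoch_inf t q).
Proof.
  intros Hq.
  assert (H : Clim (qpoch t q) (CSeries (qbinom_term q 0 t))).
  { apply Clim_quotient with (fun n => CSeries (qbinom_term q (q ^ n * 0) (q ^ n * t))).
    - intros n. rewrite qbinom_functional_iter by (rewrite ?Cmod_0; lra).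
      rewrite qpoch_0_l. ring.
    - apply qbinom_sum_tends_1; rewrite ?Cmod_0; lra. }
  unfold qpoch_inf. now rewrite (CLim_seq_unique _ _ H).
Qed.

Lemma qpoch_inf_CSeries (q s t : C) :
  (Cmod q < 1)%R -> (Cmod s < 1)%R ->
  qpoch_inf t q = qpoch_inf s q * CSeries (qbinom_term q s t).
Proof.
  intros Hq Hs.
  apply (Clim_unique (fun n => qpoch s q n * CSeries (qbinom_term q s t))).
  - apply Clim_ext with (fun n => qpoch t q n * CSeries (qbinom_term q (q ^ n * s) (q ^ n * t))).
    + intros n. now apply qbinom_functional_iter.
    + rewrite <- (Cmult_1_r (qpoch_inf t q)).
      apply Clim_mult; [now apply qpoch_tends | now apply qbinom_sum_tends_1].
  - apply Clim_mult; [now apply qpoch_tends | apply Clim_const].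
Qed.

Lemma qpoch_inf_0 (q : C) : qpoch_inf 0 q = 1.
Proof.
  apply CLim_seq_unique, Clim_ext with (fun _ => 1).
  - intros n. now rewrite qpoch_0_l.
  - apply Clim_const.
Qed.

(** At [t = 0] the functional equation exhibits an inverse. *)
Lemma qpoch_inf_neq0 (q s : C) :
  (Cmod q < 1)%R -> (Cmod s < 1)%R -> qpoch_inf s q <> 0.
Proof.
  intros Hq Hs H. generalize (qpoch_inf_CSeries q s 0 Hq Hs).
  rewrite H, qpoch_inf_0, Cmult_0_l. apply C1_nz.
Qed.

(** Iterating the functional equation gives
    [(t;q)_n f(q^n s, q^n t) = (s;q)_n f(s, t)], and [f(q^n s, q^n t)] tends
    to [f(0, 0) = 1]. *)
Theorem q_binomial (q s t : C) :
  (Cmod q < 1)%R -> (Cmod s < 1)%R ->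
  is_series (qbinom_term q s t) (qpoch_inf t q / qpoch_inf s q).
Proof.
  intros Hq Hs.
  rewrite (qpoch_inf_CSeries q s t Hq Hs).
  replace (_ / _) with (CSeries (qbinom_term q s t)).
  - now apply CSeries_correct, ex_series_qbinom.
  - field. now apply qpoch_inf_neq0.
Qed.

Lemma qpoch_inf_shift (q s : C) :
  (Cmod q < 1)%R -> qpoch_inf s q = (1 - s) * qpoch_inf (q * s) q.
Proof.
  intros Hq.
  apply (Clim_unique (fun n => qpoch s q (S n))).
  - apply (is_lim_seq_incr_1 (fun n => Cmod (qpoch s q n - qpoch_inf s q))).
    now apply qpoch_tends.
  - apply Clim_ext with (fun n => (1 - s) * qpoch (q * s) q n).
    + intros n. induction n as [|n IH]; [simpl; ring|].
      transitivity (qpoch s q (S n) * (1 - s * q ^ S n)); [|reflexivity].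
      rewrite <- IH. simpl. ring.
    + apply Clim_mult; [apply Clim_const | now apply qpoch_tends].
Qed.

(** * Sums over the antidiagonals of the double series *)

Lemma half_step (n : nat) : (S n * n / 2 = n * (n - 1) / 2 + n)%nat.
Proof.
  rewrite <- Nat.div_add by lia. f_equal. destruct n; simpl; lia.
Qed.

Lemma cauchy_poly_0_l (q t : C) (n : nat) :
  cauchy_poly 0 t q n = (- (1)) ^ n * q ^ (n * (n - 1) / 2)%nat * t ^ n.
Proof.
  induction n as [|n IH]; [simpl; ring|].
  replace (S n * (S n - 1) / 2)%nat with (n * (n - 1) / 2 + n)%nat
    by (rewrite <- half_step; f_equal; lia).
  rewrite Cpow_add_r, !Cpow_S.
  change (cauchy_poly 0 t q (S n)) with (cauchy_poly 0 t q n * (0 - t * q ^ n)).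
  rewrite IH. ring.
Qed.

Lemma cauchy_poly_0_r (q s : C) (n : nat) : cauchy_poly s 0 q n = s ^ n.
Proof. induction n as [|n IH]; simpl; [|rewrite IH]; ring. Qed.

(** The coefficient of the double series is a product of terms of the two series
    of Euler, for [(t;q)_oo] and for [1 / (s;q)_oo]. *)
Lemma rogers_coef_split (q s t : C) (n m : nat) :
  rogers_coef q s t n m = qbinom_term q 0 t n * qbinom_term q s 0 m.
Proof.
  unfold rogers_coef, qbinom_term. rewrite cauchy_poly_0_l, cauchy_poly_0_r.
  unfold Cdiv. ring.
Qed.

Lemma sum_n_Cmult_l (c : C) (u : nat -> C) (n : nat) :
  sum_n (fun k => c * u k) n = c * sum_n u n.
Proof. apply (sum_n_mult_l (K := C_Ring)). Qed.

Lemma sum_n_Cmult_r (c : C) (u : nat -> C) (n : nat) :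
  sum_n (fun k => u k * c) n = sum_n u n * c.
Proof. apply (sum_n_mult_r (K := C_Ring)). Qed.

Lemma sum_n_split_0 (u : nat -> C) (n : nat) :
  sum_n u (S n) = u 0%nat + sum_n (fun k => u (S k)) n.
Proof.
  induction n as [|n IH].
  - rewrite sum_Sn, !sum_O. reflexivity.
  - rewrite sum_Sn, IH, sum_Sn. unfold plus; simpl. ring.
Qed.

(** The finite form of the q-binomial theorem. Writing
    [1 - q^(N+1) = (1 - q^m) + q^m (1 - q^n)] for [n + m = N + 1], each half
    lowers one of the two indices, so both sides satisfy the recursion
    [(1 - q^(N+1)) u_(N+1) = (s - t q^N) u_N]. *)
Lemma rogers_coef_antidiagonal (q s t : C) (N : nat) :
  (Cmod q < 1)%R ->
  sum_n (fun n => rogers_coef q s t n (N - n)) N = qbinom_term q s t N.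
Proof.
  intros Hq. induction N as [|N IH].
  - rewrite sum_O. unfold rogers_coef, qbinom_term. simpl. field.
  - assert (HN : 1 - q ^ S N <> 0).
    { simpl. now apply Cmod_lt_1_neq, Cmod_mul_pow_lt_1. }
    assert (Cancel : forall u v : C, (1 - q ^ S N) * u = (1 - q ^ S N) * v -> u = v).
    { intros u v E. replace u with (/ (1 - q ^ S N) * ((1 - q ^ S N) * u)) by (field; exact HN).
      rewrite E. field. exact HN. }
    apply Cancel. rewrite qbinom_term_S, <- IH by exact Hq.
    set (g := qbinom_term q 0 t). set (h := qbinom_term q s 0).
    assert (Hsplit : forall M, sum_n (fun n => rogers_coef q s t n (M - n)) M
                               = sum_n (fun n => g n * h (M - n)%nat) M).
    { intros M. apply sum_n_ext. intros n. apply rogers_coef_split. }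
    rewrite !Hsplit.
    assert (Hg : forall n, (1 - q ^ S n) * g (S n) = - t * q ^ n * g n).
    { intros n. unfold g. rewrite qbinom_term_S by exact Hq. ring. }
    assert (Hh : forall n, (1 - q ^ S n) * h (S n) = s * h n).
    { intros n. unfold h. rewrite qbinom_term_S by exact Hq. ring. }
    rewrite <- sum_n_Cmult_l.
    rewrite (sum_n_ext_loc _ (fun n => plus (g n * ((1 - q ^ (S N - n)) * h (S N - n)%nat))
              (q ^ (S N - n) * ((1 - q ^ n) * g n) * h (S N - n)%nat))).
    2: { intros n Hn. change plus with Cplus.
         replace (q ^ S N) with (q ^ n * q ^ (S N - n)).
         - eqC. ring.
         - rewrite <- Cpow_add_r. now replace (n + (S N - n))%nat with (S N) by lia. }
    rewrite (sum_n_plus (G := C_AbelianMonoid)).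
    rewrite sum_Sn, (sum_n_split_0
      (fun n => q ^ (S N - n) * ((1 - q ^ n) * g n) * h (S N - n)%nat)).
    rewrite (sum_n_ext_loc _ (fun n => s * (g n * h (N - n)%nat)) N).
    2: { intros n Hn. replace (S N - n)%nat with (S (N - n)) by lia. rewrite Hh. eqC. ring. }
    rewrite (sum_n_ext_loc (fun k => q ^ (S N - S k) * _ * _)
               (fun n => (- t * q ^ N) * (g n * h (N - n)%nat)) N).
    2: { intros n Hn. rewrite Hg. replace (S N - S n)%nat with (N - n)%nat by lia.
         replace (q ^ N) with (q ^ (N - n) * q ^ n).
         - eqC. ring.
         - rewrite <- Cpow_add_r. f_equal. lia. }
    rewrite !sum_n_Cmult_l, Nat.sub_diag. change plus with Cplus. simpl. ring.
Qed.

(** * Weighted sums *)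

(** The eigenvalue at [z^N] of the product over [i < k] of the q-difference
    operators [f(z) -> f(z/q) - q^(-i) f(z)]. It is the factor
    [q^(- N k) (q;q)_N / (q;q)_(N-k)] of the k-th term of psi when [k <= N], and
    extends it by 0 to [N < k]. *)
Fixpoint weight (q : C) (k N : nat) : C :=
  match k with
  | O => 1
  | S j => weight q j N * (/ q ^ N - / q ^ j)
  end.

Lemma weight_small (q : C) (k N : nat) : (N < k)%nat -> weight q k N = 0.
Proof.
  induction k as [|k IH]; intros H; [lia|]. simpl.
  destruct (Nat.eq_dec N k) as [->|Hne].
  - ring.
  - rewrite IH by lia. ring.
Qed.

Lemma weight_qpoch (q : C) (k N : nat) :
  q <> 0 -> (k <= N)%nat ->
  weight q k N * qpoch q q (N - k) * q ^ (N * k) = qpoch q q N.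
Proof.
  intros Hq. induction k as [|k IH]; intros H.
  - rewrite Nat.sub_0_r, Nat.mul_0_r. simpl. ring.
  - rewrite <- IH by lia.
    replace (N - k)%nat with (S (N - S k)) by lia.
    rewrite Nat.mul_succ_r, Cpow_add_r. simpl.
    replace (q * q ^ (N - S k)) with (q ^ N * / q ^ k).
    + field. auto using Cpow_nz.
    + replace N with (k + S (N - S k))%nat at 1 by lia.
      rewrite Cpow_add_r. simpl. field. auto using Cpow_nz.
Qed.

(** The sum of the q-binomial series at [(s, t)] with weights [weight q k]. Up to
    a constant factor it is [(t;q)_oo / (s;q)_oo] times
    [(t/s;q)_k / (q/s;q)_k], in a form without division by [s]. *)
Definition weighted_value (q s t : C) (k : nat) : C :=
  cauchy_poly s t q k / q ^ (k * k) * (qpoch_inf t q / qpoch_inf (s / q ^ k) q).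

(** After removing common factors, this is
    [(1 - t/q) - (1 - s/q^(k+1)) = (s - t q^k) / q^(k+1)]. *)
Lemma weighted_value_S (q s t : C) (k : nat) :
  q <> 0 -> (Cmod q < 1)%R -> (Cmod (s / q ^ S k) < 1)%R ->
  weighted_value q (s / q) (t / q) k - / q ^ k * weighted_value q s t k
  = weighted_value q s t (S k).
Proof.
  intros Hq0 Hq Hs. unfold weighted_value.
  assert (Hqk : q ^ k <> 0) by now apply Cpow_nz.
  replace (s / q) with (/ q * s) by (field; exact Hq0).
  replace (t / q) with (/ q * t) by (field; exact Hq0).
  rewrite cauchy_poly_scale, Cpow_inv by exact Hq0.
  rewrite (qpoch_inf_shift q (/ q * t)) by exact Hq.
  replace (/ q * s / q ^ k) with (s / q ^ S k) by (simpl; field; auto).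
  replace (q * (/ q * t)) with t by (field; exact Hq0).
  generalize (qpoch_inf_neq0 q _ Hq Hs).
  rewrite (qpoch_inf_shift q (s / q ^ S k)) by exact Hq.
  replace (q * (s / q ^ S k)) with (s / q ^ k) by (simpl; field; auto).
  intros Hne.
  assert (Hne1 : 1 - s / q ^ S k <> 0) by (intros E; apply Hne; rewrite E; ring).
  assert (Hne2 : qpoch_inf (s / q ^ k) q <> 0) by (intros E; apply Hne; rewrite E; ring).
  replace (S k * S k)%nat with (k * k + k + k + 1)%nat by lia.
  rewrite !Cpow_add_r, Cpow_1_r. simpl cauchy_poly.
  assert (Hne3 : q * q ^ k - s <> 0).
  { intros E. apply Hne1. simpl.
    replace (1 - s / (q * q ^ k)) with ((q * q ^ k - s) / (q * q ^ k)) by (field; auto).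
    rewrite E. field. auto. }
  assert (Hkk : q ^ (k * k) <> 0) by now apply Cpow_nz.
  simpl Cpow. field. auto.
Qed.

(** The relation [R w l] stands for: [l] is the sum of the series with weights [w n]
    in total degree [n]. The only facts used about the summation are its
    linearity and its value on geometric weights, so the same induction serves
    the iterated double series and the series over total degrees. The step is
    [z^n weight q (k+1) n = (z/q)^n weight q k n - q^(-k) z^n weight q k n]:
    dividing [z] by [q] is what shrinks the domain to [|z s| < |q|^k]. *)
Lemma weighted_sum (q s t : C) (R : (nat -> C) -> C -> Prop) :
  q <> 0 -> (Cmod q < 1)%R ->
  (forall u v l, (forall n, u n = v n) -> R u l -> R v l) ->
  (forall u v l m c, R u l -> R v m -> R (fun n => u n - c * v n) (l - c * m)) ->
  (forall z, (Cmod (z * s) < 1)%R ->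
     R (fun n => z ^ n) (qpoch_inf (z * t) q / qpoch_inf (z * s) q)) ->
  forall k z, (Cmod (z * s / q ^ k) < 1)%R ->
    R (fun n => z ^ n * weight q k n) (weighted_value q (z * s) (z * t) k).
Proof.
  intros Hq0 Hq Hext Hlin Hbase k. induction k as [|k IH]; intros z Hz.
  - replace (z * s / q ^ 0) with (z * s) in Hz by (simpl; field).
    replace (weighted_value q (z * s) (z * t) 0)
      with (qpoch_inf (z * t) q / qpoch_inf (z * s) q).
    + apply Hext with (fun n => z ^ n); [intros; simpl; ring | auto].
    + unfold weighted_value. simpl.
      replace (z * s / 1) with (z * s) by field.
      field. now apply qpoch_inf_neq0.
  - assert (Hqk : q ^ k <> 0) by now apply Cpow_nz.
    rewrite <- weighted_value_S by assumption.
    apply Hext with (fun n => (z / q) ^ n * weight q k n - / q ^ k * (z ^ n * weight q k n)).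
    + intros n. simpl. unfold Cdiv. rewrite Cpow_mult_l, Cpow_inv by exact Hq0. ring.
    + apply Hlin.
      * replace (z * s / q) with (z / q * s) by (field; exact Hq0).
        replace (z * t / q) with (z / q * t) by (field; exact Hq0).
        apply IH. replace (z / q * s / q ^ k) with (z * s / q ^ S k); [exact Hz|].
        simpl. field. auto.
      * apply IH. replace (z * s / q ^ k) with (z * s / q ^ S k * q ^ 1).
        -- now apply Cmod_mul_pow_lt_1.
        -- simpl. field. auto.
Qed.

(** * Iterated series *)

Lemma is_series2_ext (u v : nat -> nat -> C) (l : C) :
  (forall n m, u n m = v n m) -> is_series2 u l -> is_series2 v l.
Proof.
  intros H [w [Hw Hl]]. exists w. split; [|exact Hl]. intros n.
  apply (is_series_ext (V := C_NormedModule)) with (u n); [apply H | apply Hw].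
Qed.

Lemma is_series2_lin (u v : nat -> nat -> C) (l l' c : C) :
  is_series2 u l -> is_series2 v l' ->
  is_series2 (fun n m => u n m + c * v n m) (l + c * l').
Proof.
  intros [w [Hw Hl]] [w' [Hw' Hl']]. exists (fun n => w n + c * w' n). split.
  - intros n. apply (is_series_plus (V := C_NormedModule)); [apply Hw|].
    apply (is_series_scal_l (V := C_NormedModule)), Hw'.
  - apply (is_series_plus (V := C_NormedModule)); [exact Hl|].
    apply (is_series_scal_l (V := C_NormedModule)), Hl'.
Qed.

Lemma is_series2_prod (u v : nat -> C) (l l' : C) :
  is_series u l -> is_series v l' -> is_series2 (fun n m => u n * v m) (l * l').
Proof.
  intros Hu Hv. exists (fun n => u n * l'). split.
  - intros n. now apply (is_series_scal_l (V := C_NormedModule)).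
  - rewrite Cmult_comm.
    apply (is_series_ext (V := C_NormedModule)) with (fun n => l' * u n).
    + intros n. eqC. ring.
    + now apply (is_series_scal_l (V := C_NormedModule)).
Qed.

Lemma is_series2_sum (u : nat -> nat -> nat -> C) (l : nat -> C) (K : nat) :
  (forall k, is_series2 (u k) (l k)) ->
  is_series2 (fun n m => sum_n (fun k => u k n m) K) (sum_n l K).
Proof.
  intros H. induction K as [|K IH].
  - rewrite sum_O. apply is_series2_ext with (u 0%nat); [|apply H].
    intros. now rewrite sum_O.
  - rewrite sum_Sn. replace (plus _ _) with (sum_n l K + 1 * l (S K))
      by (unfold plus; simpl; eqC; ring).
    apply is_series2_ext with (fun n m => sum_n (fun k => u k n m) K + 1 * u (S K) n m).
    + intros. rewrite sum_Sn. unfold plus; simpl. eqC. ring.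
    + now apply is_series2_lin.
Qed.

(** On geometric weights the double series separates into a product, so its
    iterated sums are computed by Euler's two series, with no interchange of
    summations. *)
Lemma weighted_double_sum (q s t z : C) (k : nat) :
  q <> 0 -> (Cmod q < 1)%R -> (Cmod (z * s / q ^ k) < 1)%R ->
  is_series2 (fun n m => z ^ (n + m) * weight q k (n + m) * rogers_coef q s t n m)
    (weighted_value q (z * s) (z * t) k).
Proof.
  intros Hq0 Hq.
  apply (weighted_sum q s t
           (fun w => is_series2 (fun n m => w (n + m)%nat * rogers_coef q s t n m)));
    try assumption.
  - intros u v l H. apply is_series2_ext. intros. now rewrite H.
  - intros u v l m c H H'.
    replace (l - c * m) with (l + - c * m) by ring.
    apply is_series2_ext with (2 := is_series2_lin _ _ _ _ (- c) H H').
    intros; simpl; ring.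
  - intros w Hw.
    apply is_series2_ext with (fun n m => qbinom_term q 0 (w * t) n * qbinom_term q (w * s) 0 m).
    + intros n m. rewrite rogers_coef_split, Cpow_add_r.
      replace (qbinom_term q 0 (w * t) n) with (w ^ n * qbinom_term q 0 t n).
      replace (qbinom_term q (w * s) 0 m) with (w ^ m * qbinom_term q s 0 m).
      * ring.
      * rewrite <- qbinom_term_scale. f_equal. ring.
      * rewrite <- qbinom_term_scale. f_equal. ring.
    + replace (_ / _) with (qpoch_inf (w * t) q / qpoch_inf 0 q
                             * (qpoch_inf 0 q / qpoch_inf (w * s) q)).
      * apply is_series2_prod; apply q_binomial; rewrite ?Cmod_0; lra.
      * rewrite qpoch_inf_0. field. now apply qpoch_inf_neq0.
Qed.

Lemma weighted_single_sum (q s t z : C) (k : nat) :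
  q <> 0 -> (Cmod q < 1)%R -> (Cmod (z * s / q ^ k) < 1)%R ->
  is_series (fun N => z ^ N * weight q k N * qbinom_term q s t N)
    (weighted_value q (z * s) (z * t) k).
Proof.
  intros Hq0 Hq.
  apply (weighted_sum q s t (fun w => is_series (fun N => w N * qbinom_term q s t N)));
    try assumption.
  - intros u v l H. apply (is_series_ext (V := C_NormedModule)). intros. now rewrite H.
  - intros u v l m c H H'.
    apply (is_series_ext (V := C_NormedModule))
      with (fun n => u n * qbinom_term q s t n - c * (v n * qbinom_term q s t n)).
    + intros. eqC. ring.
    + apply (is_series_minus (V := C_NormedModule)); [exact H|].
      now apply (is_series_scal_l (V := C_NormedModule)).
  - intros w Hw. apply (is_series_ext (V := C_NormedModule)) with (qbinom_term q (w * s) (w * t)).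
    + intros. apply qbinom_term_scale.
    + now apply q_binomial.
Qed.

(** * The polynomials psi and the terms of the hypergeometric series *)

Lemma half_double (k : nat) : (k * (k + 1) / 2 + k * (k + 1) / 2 = k * k + k)%nat.
Proof.
  replace (k * (k + 1))%nat with (S k * k)%nat by lia.
  induction k as [|k IH]; [reflexivity|].
  rewrite half_step. replace (S k * (S k - 1))%nat with (S k * k)%nat by lia. lia.
Qed.

Lemma qpochs_snoc (l : list C) (c q : C) (n : nat) :
  qpochs (l ++ c :: nil) q n = qpochs l q n * qpoch c q n.
Proof.
  unfold qpochs. induction l as [|d l IH]; simpl; [ring|]. rewrite IH. ring.
Qed.

Lemma qpochs_neq0 (l : list C) (q : C) (n : nat) :
  (forall (c : C) (i : nat), In c l -> c * q ^ i <> 1) -> qpochs l q n <> 0.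
Proof.
  unfold qpochs. induction l as [|d l IH]; intros H; simpl; [apply C1_nz|].
  apply Cmult_neq_0.
  - clear IH. induction n as [|n IH]; simpl; [apply C1_nz|].
    apply Cmult_neq_0; [exact IH|]. intros E. apply (H d n); [now left|].
    replace (d * q ^ n) with (1 - (1 - d * q ^ n)) by ring. rewrite E. ring.
  - apply IH. intros c i Hc. apply H. now right.
Qed.

(** The [k] extra factors [1 - u / q^i], for [1 <= i <= k], are
    [- u q^(-i) (1 - q^i / u)]: reversing them produces [(q/u;q)_k]. *)
Lemma qpoch_inf_shift_down (q u : C) (k : nat) :
  q <> 0 -> (Cmod q < 1)%R -> u <> 0 ->
  qpoch_inf (u / q ^ k) q
  = (- (1)) ^ k * u ^ k / q ^ (k * (k + 1) / 2)%nat * qpoch (q / u) q k * qpoch_inf u q.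
Proof.
  intros Hq0 Hq Hu. induction k as [|k IH].
  - simpl. replace (u / 1) with u by field. field.
  - assert (Hqk : q ^ k <> 0) by now apply Cpow_nz.
    rewrite qpoch_inf_shift by exact Hq.
    replace (q * (u / q ^ S k)) with (u / q ^ k) by (simpl; field; auto).
    rewrite IH.
    replace (S k * (S k + 1) / 2)%nat with (k * (k + 1) / 2 + S k)%nat.
    + assert (Hqt : q ^ (k * (k + 1) / 2)%nat <> 0) by now apply Cpow_nz.
      rewrite Cpow_add_r, !Cpow_S.
      change (qpoch (q / u) q (S k)) with (qpoch (q / u) q k * (1 - q / u * q ^ k)).
      field. auto.
    + rewrite (Nat.mul_comm (S k)), (Nat.add_1_r (S k)), half_step.
      rewrite Nat.sub_succ, Nat.sub_0_r. do 2 f_equal. lia.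
Qed.

(** What remains of the k-th term of psi once its dependence on the degree [N]
    is put into [y^N weight q k N]. *)
Definition psi_coef (a b : list C) (q x y : C) (k : nat) : C :=
  qpochs a q k / qpochs b q k * (- (1)) ^ k * q ^ (k * (k + 1) / 2)%nat
  * (x / y) ^ k / qpoch q q k.

Lemma psi_term_weight (a b : list C) (q x y : C) (N k : nat) :
  q <> 0 -> (Cmod q < 1)%R -> y <> 0 -> (k <= N)%nat ->
  psi_term a b q x y N k = psi_coef a b q x y k * (y ^ N * weight q k N).
Proof.
  intros Hq0 Hq Hy HkN. unfold psi_term, psi_coef, qbinom.
  rewrite <- (weight_qpoch q k N) by assumption.
  replace (y ^ N) with (y ^ k * y ^ (N - k)) by (rewrite <- Cpow_add_r; f_equal; lia).
  replace ((x / y) ^ k) with (x ^ k / y ^ k)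
    by (unfold Cdiv; now rewrite Cpow_mult_l, Cpow_inv by exact Hy).
  set (r := qpochs a q k / qpochs b q k).
  field. repeat split; auto using qpoch_neq0, Cpow_nz.
Qed.

(** Since the weights vanish for [N < k], the range of [k] can be made
    independent of [N], which is what allows the sum over [k] to be pulled out
    of the double series. *)
Lemma psi_weight (a b : list C) (q x y : C) (N K : nat) :
  q <> 0 -> (Cmod q < 1)%R -> y <> 0 ->
  (forall k, (K < k)%nat -> (k <= N)%nat -> psi_coef a b q x y k = 0) ->
  psi a b q x y N
  = sum_n (fun k => psi_coef a b q x y k * (y ^ N * weight q k N)) K.
Proof.
  intros Hq0 Hq Hy H0.
  assert (Hpad : forall L d, (forall k, (L < k)%nat ->
                   psi_coef a b q x y k * (y ^ N * weight q k N) = 0) ->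
            sum_n (fun k => psi_coef a b q x y k * (y ^ N * weight q k N)) (L + d)
            = sum_n (fun k => psi_coef a b q x y k * (y ^ N * weight q k N)) L).
  { intros L d HL. induction d as [|d IH]; [now rewrite Nat.add_0_r|].
    rewrite Nat.add_succ_r, sum_Sn, IH, HL by lia.
    change plus with Cplus. eqC. ring. }
  transitivity (sum_n (fun k => psi_coef a b q x y k * (y ^ N * weight q k N)) N).
  { apply sum_n_ext_loc. intros k Hk. now apply psi_term_weight. }
  rewrite <- (Hpad N K), <- (Hpad K N).
  - now rewrite Nat.add_comm.
  - intros k Hk. destruct (Nat.le_gt_cases k N) as [HkN|HkN].
    + rewrite H0 by assumption. ring.
    + rewrite weight_small by exact HkN. ring.
  - intros k Hk. rewrite weight_small by exact Hk. ring.
Qed.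

Lemma Phi_term_psi_coef (a b : list C) (q x y u v : C) (k : nat) :
  q <> 0 -> (Cmod q < 1)%R -> y <> 0 -> qpochs b q k <> 0 ->
  psi_coef a b q x y k = 0 ->
  Phi_term (a ++ u :: nil) (b ++ v :: nil) q (x * q / y) k = 0.
Proof.
  intros Hq0 Hq Hy Hb H. unfold Phi_term. rewrite !qpochs_snoc.
  assert (E : qpochs a q k * (x / y) ^ k = 0).
  { set (c := qpochs b q k * qpoch q q k * (- (1)) ^ k / q ^ (k * (k + 1) / 2)%nat).
    transitivity (c * psi_coef a b q x y k); [|rewrite H; ring].
    assert (H1 : (- (1)) ^ k * (- (1)) ^ k = 1).
    { rewrite <- Cpow_mult_l. replace (- (1) * - (1)) with (RtoC 1) by ring. apply Cpow_1_l. }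
    unfold c, psi_coef.
    transitivity (qpochs a q k * (x / y) ^ k * ((- (1)) ^ k * (- (1)) ^ k)).
    - rewrite H1. ring.
    - field. repeat split; auto using qpoch_neq0, Cpow_nz. }
  replace (x * q / y) with (x / y * q) by (field; exact Hy).
  rewrite Cpow_mult_l.
  transitivity (qpochs a q k * (x / y) ^ k
    * (qpoch u q k * / (qpochs b q k * qpoch v q k) * (q ^ k * / qpoch q q k))).
  - unfold Cdiv. ring.
  - rewrite E. ring.
Qed.

Lemma psi_coef_weighted_value (a b : list C) (q x y s t : C) (k : nat) :
  q <> 0 -> (Cmod q < 1)%R -> y <> 0 -> s <> 0 -> qpochs b q k <> 0 ->
  (Cmod (y * s / q ^ k) < 1)%R ->
  psi_coef a b q x y k * weighted_value q (y * s) (y * t) k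
  = qpoch_inf (y * t) q / qpoch_inf (y * s) q
    * Phi_term (a ++ t / s :: nil) (b ++ q / (y * s) :: nil) q (x * q / y) k.
Proof.
  intros Hq0 Hq Hy Hs Hb Hk.
  assert (Hu : y * s <> 0) by now apply Cmult_neq_0.
  generalize (qpoch_inf_neq0 q _ Hq Hk).
  unfold weighted_value, Phi_term, psi_coef. rewrite !qpochs_snoc.
  rewrite (qpoch_inf_shift_down q (y * s) k) by assumption. intros Hne.
  assert (Hsgn : (- (1)) ^ k <> 0).
  { apply Cpow_nz. intros E. apply C1_nz.
    replace (RtoC 1) with (- - (1)) by ring. rewrite E. ring. }
  assert (HZ : qpoch (q / (y * s)) q k <> 0) by (intros E; apply Hne; rewrite E; ring).
  assert (HY : qpoch_inf (y * s) q <> 0) by (intros E; apply Hne; rewrite E; ring).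
  rewrite cauchy_poly_qpoch by exact Hu.
  replace (y * t / (y * s)) with (t / s) by (field; auto).
  replace (x * q / y) with (x / y * q) by (field; exact Hy).
  rewrite (Cpow_mult_l (x / y) q).
  replace (q ^ k) with (q ^ (k * (k + 1) / 2)%nat * q ^ (k * (k + 1) / 2)%nat / q ^ (k * k)).
  - assert (Hqt : q ^ (k * (k + 1) / 2)%nat <> 0) by now apply Cpow_nz.
    assert (Hqk : q ^ (k * k)%nat <> 0) by now apply Cpow_nz.
    assert (Huk : (y * s) ^ k <> 0) by now apply Cpow_nz.
    set (w := (x / y) ^ k). set (U := (y * s) ^ k) in *.
    set (Z := qpoch (q / (y * s)) q k) in *. set (T := qpoch (t / s) q k).
    field. repeat split; auto using qpoch_neq0.
  - rewrite <- Cpow_add_r.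
    replace (k * (k + 1) / 2 + k * (k + 1) / 2)%nat with (k * k + k)%nat.
    + rewrite Cpow_add_r. field. now apply Cpow_nz.
    + symmetry. apply half_double.
Qed.

(** * The identity when the expanded double series converges absolutely *)

Lemma sum_n_ge_term (u : nat -> R) (i n : nat) :
  (forall k, 0 <= u k)%R -> (i <= n)%nat -> (u i <= sum_n u n)%R.
Proof.
  intros Hu. induction n as [|n IH]; intros Hi.
  - replace i with 0%nat by lia. rewrite sum_O. apply Rle_refl.
  - assert (H0 : forall m, (0 <= sum_n u m)%R).
    { intros m. induction m as [|m IHm]; [rewrite sum_O; apply Hu|].
      rewrite sum_Sn. generalize (Hu (S m)). unfold plus; simpl. lra. }
    rewrite sum_Sn. unfold plus; simpl.
    destruct (Nat.eq_dec i (S n)) as [->|Hne].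
    + generalize (H0 n). lra.
    + generalize (Hu (S n)) (IH ltac:(lia)). lra.
Qed.

Lemma sum_n_pos (u : nat -> R) (n : nat) : (forall k, 0 <= u k)%R -> (0 <= sum_n u n)%R.
Proof.
  intros Hu. apply Rle_trans with (u 0%nat); [apply Hu|].
  apply sum_n_ge_term; [exact Hu | lia].
Qed.

Lemma Cmod_qpoch_bounded (q t : C) :
  (Cmod q < 1)%R -> exists B : R, forall n, (Cmod (qpoch t q n) <= B)%R.
Proof.
  intros Hq.
  destruct (filterlim_bounded (V := C_NormedModule) (qpoch t q)) as [B HB].
  - exists (qpoch_inf t q). now apply filterlim_Clim, qpoch_tends.
  - exists B. exact HB.
Qed.

(** Absolute convergence is very restrictive. The terms with [n = 0] and fixed
    [k] have modulus [|psi_coef k| |y s / q^k|^m / |(q;q)_(m-k)|], whose last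
    denominator is bounded; when [|y s| >= |q|^k] they do not tend to 0 unless
    [psi_coef k] vanishes. As [|q|^k] tends to 0, only finitely many [k]
    survive if [y s] is not 0. *)
Lemma abs_cv_psi_coef (a b : list C) (q x y s t : C) (k : nat) :
  q <> 0 -> (Cmod q < 1)%R -> y <> 0 ->
  rogers_abs_cv a b q x y s t -> (Cmod q ^ k <= Cmod (y * s))%R ->
  psi_coef a b q x y k = 0.
Proof.
  intros Hq0 Hq Hy [M HM] Hk.
  set (v := fun m => sum_n (fun k =>
              Cmod (rogers_coef q s t 0 m * psi_term a b q x y (0 + m) k)) (0 + m)).
  assert (Hv0 : forall m, (0 <= v m)%R).
  { intros m. apply sum_n_pos. intros; apply Cmod_ge_0. }
  assert (Hv : is_lim_seq v 0).
  { apply ex_series_lim_0. apply (ex_finite_lim_seq_incr (sum_n v) M).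
    - intros n. rewrite sum_Sn. generalize (Hv0 (S n)). unfold plus; simpl. lra.
    - intros N. eapply Rle_trans; [|apply (HM N)].
      apply (sum_n_ge_term (fun n => sum_n (fun m => sum_n (fun k =>
        Cmod (rogers_coef q s t n m * psi_term a b q x y (n + m) k)) (n + m)) N) 0 N); [|lia].
      intros n. apply sum_n_pos. intros m. apply sum_n_pos. intros; apply Cmod_ge_0. }
  destruct (Cmod_qpoch_bounded q q Hq) as [B HB].
  assert (Hlow : forall j, (Cmod (psi_coef a b q x y k) <= v (j + k)%nat * B)%R).
  { intros j. set (m := (j + k)%nat).
    apply Rle_trans with
      (Cmod (rogers_coef q s t 0 m * psi_term a b q x y m k) * Cmod (qpoch q q j))%R.
    - rewrite <- Cmod_mult, psi_term_weight by (unfold m; auto; lia).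
      assert (Hqm : qpoch q q m <> 0) by now apply qpoch_neq0.
      assert (Hqmk : q ^ (m * k) <> 0) by now apply Cpow_nz.
      replace (_ * _ * _) with (psi_coef a b q x y k * ((y * s) ^ m / q ^ (m * k))).
      + rewrite Cmod_mult.
        rewrite <- (Rmult_1_r (Cmod (psi_coef a b q x y k))) at 1.
        apply Rmult_le_compat_l; [apply Cmod_ge_0|].
        rewrite Cmod_div, !Cmod_pow by exact Hqmk.
        rewrite Nat.mul_comm, pow_mult.
        assert (Hpos : (0 < (Cmod q ^ k) ^ m)%R).
        { apply pow_lt, pow_lt. now apply Cmod_gt_0. }
        apply Rmult_le_reg_r with ((Cmod q ^ k) ^ m)%R; [exact Hpos|].
        rewrite Rmult_1_l. unfold Rdiv. rewrite Rmult_assoc, Rinv_l, Rmult_1_r by lra.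
        apply pow_incr. split; [apply pow_le, Cmod_ge_0 | exact Hk].
      + unfold rogers_coef. rewrite <- (weight_qpoch q k m) in Hqm |- * by (unfold m; auto; lia).
        replace (m - k)%nat with j in * by (unfold m; lia).
        rewrite Cpow_mult_l. simpl. field. repeat split; auto.
        * intros E. apply Hqm. rewrite E. ring.
        * intros E. apply Hqm. rewrite E. ring.
    - apply Rmult_le_compat; try apply Cmod_ge_0; [|apply HB].
      apply (sum_n_ge_term (fun k => Cmod (rogers_coef q s t 0 m * psi_term a b q x y (0 + m) k)));
        [intros; apply Cmod_ge_0 | unfold m; lia]. }
  apply Cmod_eq_0, Rle_antisym; [|apply Cmod_ge_0].
  apply (is_lim_seq_le (fun _ => Cmod (psi_coef a b q x y k)) (fun j => v (j + k)%nat * B)%R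
           (Cmod (psi_coef a b q x y k)) 0).
  - exact Hlow.
  - apply is_lim_seq_const.
  - replace (Finite 0) with (Finite (0 * B)) by (f_equal; ring).
    apply is_lim_seq_mult'; [|apply is_lim_seq_const].
    now apply (is_lim_seq_incr_n v k 0).
Qed.

Lemma is_series2_scal (u : nat -> nat -> C) (l c : C) :
  is_series2 u l -> is_series2 (fun n m => c * u n m) (c * l).
Proof.
  intros [w [Hw Hl]]. exists (fun n => c * w n).
  split; [intros n|]; apply (is_series_scal_l (V := C_NormedModule)); auto.
Qed.

Lemma is_series_finite (u : nat -> C) (K : nat) :
  (forall k, (K < k)%nat -> u k = 0) -> is_series u (sum_n u K).
Proof.
  intros H. apply is_series_Clim.
  apply Clim_dominated with (fun _ => 0%R); [|apply is_lim_seq_const].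
  exists K. intros n Hn. right.
  assert (E : sum_n u n = sum_n u K).
  { induction Hn as [|n Hn IH]; [reflexivity|].
    rewrite sum_Sn, IH, H by lia. change plus with Cplus. eqC. ring. }
  rewrite E. replace (sum_n u K - sum_n u K) with (RtoC 0) by ring. apply Cmod_0.
Qed.

(** All but finitely many [k] contribute nothing on either side. For each
    remaining [k], either its coefficient vanishes or [|y s| < |q|^k], where
    [weighted_double_sum] applies. *)
Lemma rogers_analytic (a b : list C) (q x y s t : C) :
  q <> 0 -> (Cmod q < 1)%R -> y <> 0 ->
  (forall (c : C) (i : nat), In c b -> c * q ^ i <> 1) ->
  s <> 0 -> rogers_abs_cv a b q x y s t ->
  ex_series (Phi_term (a ++ t / s :: nil) (b ++ q / (y * s) :: nil) q (x * q / y)) /\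
  is_series2
    (fun n m => (- (1)) ^ n * q ^ (n * (n - 1) / 2)%nat
          * psi a b q x y (n + m) * (t ^ n / qpoch q q n)
          * (s ^ m / qpoch q q m))
       (qpoch_inf (y * t) q / qpoch_inf (y * s) q
        * Phi (a ++ t / s :: nil) (b ++ q / (y * s) :: nil) q (x * q / y)).
Proof.
  intros Hq0 Hq Hy Hb Hs Hcv.
  assert (Hu : y * s <> 0) by now apply Cmult_neq_0.
  assert (HB : forall k, qpochs b q k <> 0) by (intros; now apply qpochs_neq0).
  set (T := Phi_term (a ++ t / s :: nil) (b ++ q / (y * s) :: nil) q (x * q / y)).
  (* Beyond this [K], no coefficient survives. *)
  assert (HK : exists K, (Cmod q ^ K <= Cmod (y * s))%R).
  { destruct (proj2 (is_lim_seq_spec _ _) (Cmod_pow_lim q Hq)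
                (mkposreal _ (proj1 (Cmod_gt_0 _) Hu))) as [K HK].
    exists K. specialize (HK K (le_n K)). simpl in HK.
    rewrite Rminus_0_r, Rabs_right in HK; [lra|]. apply Rle_ge, pow_le, Cmod_ge_0. }
  destruct HK as [K HK].
  assert (Hvan : forall k, (K < k)%nat -> psi_coef a b q x y k = 0).
  { intros k Hk. apply (abs_cv_psi_coef a b q x y s t k Hq0 Hq Hy Hcv).
    apply Rle_trans with (2 := HK). replace k with (K + (k - K))%nat by lia.
    rewrite pow_add. rewrite <- (Rmult_1_r (Cmod q ^ K)) at 2.
    apply Rmult_le_compat_l; [apply pow_le, Cmod_ge_0|].
    rewrite <- Cmod_pow. now apply Cmod_pow_le_1. }
  assert (HT : is_series T (sum_n T K)).
  { apply is_series_finite. intros k Hk. apply Phi_term_psi_coef; auto. }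
  split; [now exists (sum_n T K)|].
  unfold Phi. fold T. rewrite (CSeries_unique _ _ HT), <- sum_n_Cmult_l.
  apply is_series2_ext with (fun n m => sum_n (fun k =>
     psi_coef a b q x y k * (y ^ (n + m) * weight q k (n + m)) * rogers_coef q s t n m) K).
  { intros n m. rewrite sum_n_Cmult_r, <- (psi_weight a b q x y (n + m) K) by auto.
    unfold rogers_coef. ring. }
  apply is_series2_sum. intros k.
  destruct (Rle_lt_dec (Cmod q ^ k) (Cmod (y * s))) as [Hk|Hk].
  - assert (E := abs_cv_psi_coef a b q x y s t k Hq0 Hq Hy Hcv Hk).
    unfold T. rewrite Phi_term_psi_coef by auto.
    replace (_ * 0) with (0 * 0) by ring.
    apply is_series2_ext with (fun _ _ => 0 * 0).
    { intros. rewrite E. ring. }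
    assert (H0 : is_series (fun _ : nat => RtoC 0) (RtoC 0)).
    { generalize (is_series_finite (fun _ => RtoC 0) 0 (fun _ _ => eq_refl)).
      now rewrite sum_O. }
    now apply (is_series2_prod (fun _ => 0) (fun _ => 0)).
  - assert (Hk' : (Cmod (y * s / q ^ k) < 1)%R).
    { assert (Hqk : q ^ k <> 0) by now apply Cpow_nz.
      rewrite Cmod_div, Cmod_pow by exact Hqk.
      assert (0 < Cmod q ^ k)%R by (apply pow_lt; now apply Cmod_gt_0).
      apply Rmult_lt_reg_r with (Cmod q ^ k)%R; [assumption|].
      unfold Rdiv. rewrite Rmult_assoc, Rinv_l by lra. lra. }
    unfold T. rewrite <- psi_coef_weighted_value by auto.
    apply is_series2_ext with (fun n m => psi_coef a b q x y k
      * (y ^ (n + m) * weight q k (n + m) * rogers_coef q s t n m)).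
    { intros. ring. }
    now apply is_series2_scal, weighted_double_sum.
Qed.

(** * The identity of formal power series *)

Definition vanishes_to_order (K : nat) (D : C -> C -> C) : Prop :=
  exists M delta : R, (0 < delta)%R /\
    forall s t : C, s <> 0 -> (Cmod s < delta)%R -> (Cmod t < delta)%R ->
      (Cmod (D s t) <= M * (Cmod s + Cmod t) ^ K)%R.

Lemma vanishes_to_order_sum (K : nat) (D : nat -> C -> C -> C) (n : nat) :
  (forall k, vanishes_to_order K (D k)) ->
  vanishes_to_order K (fun s t => sum_n (fun k => D k s t) n).
Proof.
  intros H. induction n as [|n (M & d & Hd & IH)].
  - destruct (H 0%nat) as (M & d & Hd & H0). exists M, d. split; [exact Hd|].
    intros s t. rewrite sum_O. apply H0.
  - destruct (H (S n)) as (M' & d' & Hd' & H').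
    exists (M + M')%R, (Rmin d d'). split; [now apply Rmin_pos|].
    intros s t Hs Hds Hdt. rewrite sum_Sn. change plus with Cplus.
    generalize (Rmin_l d d') (Rmin_r d d'). intros Hl Hr.
    eapply Rle_trans; [apply Cmod_triangle|]. rewrite Rmult_plus_distr_r.
    apply Rplus_le_compat; [apply IH | apply H']; auto; lra.
Qed.

Lemma series_tail (u : nat -> C) (l : C) (A r : R) (K : nat) :
  (0 <= A)%R -> (0 <= r <= 1 / 2)%R -> (forall n, Cmod (u n) <= A * r ^ n)%R -> is_series u l ->
  (Cmod (sum_n u K - l) <= 2 * A * r ^ S K)%R.
Proof.
  intros HA Hr Hu Hl.
  replace (sum_n u K - l) with (- (l - sum_n u K)) by ring. rewrite Cmod_opp.
  apply Rle_trans with (A * r ^ S K * / (1 - r))%R.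
  - apply (Cmod_series_le (fun n => u (S K + n)%nat) (fun n => A * r ^ S K * r ^ n)%R).
    + intros n. rewrite Rmult_assoc, <- pow_add. apply Hu.
    + apply (is_series_incr_n (V := C_NormedModule) u (S K)); [lia|].
      replace (plus _ _) with (l : C_NormedModule); [exact Hl|].
      assert (E : forall c : C, l = l - c + c) by (intros; ring). apply E.
    + apply (is_series_scal_l (V := R_NormedModule)). apply is_series_geom.
      rewrite Rabs_right; lra.
  - replace (2 * A * r ^ S K)%R with (A * r ^ S K * 2)%R by ring.
    apply Rmult_le_compat_l.
    + apply Rmult_le_pos; [exact HA | now apply pow_le].
    + rewrite <- (Rinv_inv 2). apply Rinv_le_contravar; lra.
Qed.

Lemma Cmod_cauchy_poly_le (q s t : C) (n : nat) :
  (Cmod q < 1)%R -> (Cmod (cauchy_poly s t q n) <= (Cmod s + Cmod t) ^ n)%R.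
Proof.
  intros Hq. induction n as [|n IH]; simpl.
  - rewrite Cmod_1. lra.
  - rewrite Cmod_mult, Rmult_comm.
    apply Rmult_le_compat; try apply Cmod_ge_0; [|exact IH].
    eapply Rle_trans; [apply Cmod_triangle|]. rewrite Cmod_opp, Cmod_mult.
    generalize (Cmod_pow_le_1 q n Hq) (Cmod_ge_0 t). nra.
Qed.

(** A geometric bound of any ratio suffices, since [s] and [t] may be taken
    small afterwards. For [k = 0] it comes from the convergence of the series
    of [(1/2)^n / (q;q)_n]; each further factor of the weight costs [|q|^(-n)]. *)
Lemma weight_growth (q : C) (k : nat) :
  q <> 0 -> (Cmod q < 1)%R ->
  exists A r : R, (0 <= A)%R /\ (0 <= r)%R /\
    forall n, (Cmod (weight q k n / qpoch q q n) <= A * r ^ n)%R.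
Proof.
  intros Hq0 Hq. induction k as [|k (A & r & HA & Hr & IH)].
  - destruct (ex_series_Cmod_qbinom q (1 / 2) 0 Hq) as [W HW].
    { unfold Cdiv. rewrite Cmult_1_l, Cmod_inv, Cmod_R, Rabs_right; [lra|lra|].
      intros E. injection E. lra. }
    destruct (filterlim_bounded (V := R_NormedModule)
                (fun n => Cmod (qbinom_term q (1 / 2) 0 n))) as [B HB].
    { exists 0%R. apply ex_series_lim_0. now exists W. }
    assert (HB' : forall n, (Cmod (qbinom_term q (1 / 2) 0 n) <= B)%R).
    { intros n. eapply Rle_trans; [apply Rle_abs | apply HB]. }
    exists B, 2%R. split; [eapply Rle_trans; [apply Cmod_ge_0 | apply (HB' 0%nat)]|].
    split; [lra|]. intros n.
    replace (weight q 0 n / qpoch q q n) with (2 ^ n * qbinom_term q (1 / 2) 0 n).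
    + rewrite Cmod_mult, Cmod_pow, Cmod_R, Rabs_right, Rmult_comm by lra.
      apply Rmult_le_compat_r; [apply pow_le; lra | apply HB'].
    + rewrite <- qbinom_term_scale. unfold qbinom_term. rewrite Cmult_0_r, cauchy_poly_0_r.
      replace (2 * (1 / 2)) with (RtoC 1) by (field; intros E; injection E; lra).
      now rewrite Cpow_1_l.
  - assert (Hqk : forall n, q ^ n <> 0) by (intros; now apply Cpow_nz).
    assert (Hpos : forall n, (0 < Cmod q ^ n)%R) by (intros; apply pow_lt; now apply Cmod_gt_0).
    exists (A * (1 + / Cmod q ^ k))%R, (r * / Cmod q)%R.
    assert (Hik : (0 <= / Cmod q ^ k)%R) by (left; now apply Rinv_0_lt_compat).
    split; [apply Rmult_le_pos; lra|].
    split; [apply Rmult_le_pos; [exact Hr|]; left; apply Rinv_0_lt_compat; now apply Cmod_gt_0|].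
    intros n. simpl.
    replace (weight q k n * (/ q ^ n - / q ^ k) / qpoch q q n)
      with (weight q k n / qpoch q q n * (/ q ^ n - / q ^ k)) by (unfold Cdiv; ring).
    rewrite Cmod_mult, Rpow_mult_distr, pow_inv.
    replace (A * (1 + / Cmod q ^ k) * (r ^ n * / Cmod q ^ n))%R
      with (A * r ^ n * ((1 + / Cmod q ^ k) * / Cmod q ^ n))%R by ring.
    apply Rmult_le_compat; try apply Cmod_ge_0; [apply IH|].
    eapply Rle_trans; [apply Cmod_triangle|].
    rewrite Cmod_opp, !Cmod_inv, !Cmod_pow by apply Hqk.
    assert (1 <= / Cmod q ^ n)%R.
    { rewrite <- Rinv_1. apply Rinv_le_contravar; [apply Hpos|].
      rewrite <- Cmod_pow. now apply Cmod_pow_le_1. }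
    nra.
Qed.

(** The N-th term is homogeneous of degree [N] in [(s, t)], so the partial sum is
    the part of total degree at most [K], and the remainder is a geometric
    tail. *)
Lemma weighted_sum_remainder (q y : C) (k K : nat) :
  q <> 0 -> (Cmod q < 1)%R ->
  exists M delta : R, (0 < delta)%R /\
    forall s t : C, (Cmod s < delta)%R -> (Cmod t < delta)%R ->
      (Cmod (y * s / q ^ k) < 1)%R /\
      (Cmod (sum_n (fun N => y ^ N * weight q k N * qbinom_term q s t N) K
             - weighted_value q (y * s) (y * t) k)%C
       <= M * (Cmod s + Cmod t) ^ S K)%R.
Proof.
  intros Hq0 Hq. destruct (weight_growth q k Hq0 Hq) as (A & r & HA & Hr & Hw).
  set (c := Cmod (y / q ^ k)). set (d := (Cmod y * r)%R).
  assert (Hc : (0 <= c)%R) by apply Cmod_ge_0.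
  assert (Hd : (0 <= d)%R) by (apply Rmult_le_pos; [apply Cmod_ge_0 | exact Hr]).
  assert (Hqk : q ^ k <> 0) by now apply Cpow_nz.
  (* The radius makes both [|y s / q^k| < 1] and the ratio
     [d (|s| + |t|) <= 1/2] hold. *)
  exists (2 * A * d ^ S K)%R, (/ (4 * (1 + c + d)))%R.
  split; [apply Rinv_0_lt_compat; lra|]. intros s t Hs Ht.
  assert (Hdel : ((1 + c + d) * / (4 * (1 + c + d)) = 1 / 4)%R) by (field; lra).
  set (delta := (/ (4 * (1 + c + d)))%R) in *.
  generalize (Cmod_ge_0 s) (Cmod_ge_0 t). intros Hs0 Ht0.
  assert (Hcs : (Cmod (y * s / q ^ k) < 1)%R).
  { replace (y * s / q ^ k) with (y / q ^ k * s) by (unfold Cdiv; ring).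
    rewrite Cmod_mult. fold c. nra. }
  split; [exact Hcs|].
  rewrite Rmult_assoc, <- Rpow_mult_distr.
  apply series_tail.
  - exact HA.
  - split; [apply Rmult_le_pos; lra | nra].
  - intros n.
    replace (y ^ n * weight q k n * qbinom_term q s t n)
      with (y ^ n * (weight q k n / qpoch q q n) * cauchy_poly s t q n)
      by (unfold qbinom_term, Cdiv; ring).
    rewrite !Cmod_mult, Cmod_pow. unfold d. rewrite !Rpow_mult_distr.
    replace (A * (Cmod y ^ n * r ^ n * (Cmod s + Cmod t) ^ n))%R
      with (Cmod y ^ n * (A * r ^ n) * (Cmod s + Cmod t) ^ n)%R by ring.
    apply Rmult_le_compat; [apply Rmult_le_pos; [apply pow_le|]; apply Cmod_ge_0
                           | apply Cmod_ge_0 | | now apply Cmod_cauchy_poly_le].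
    apply Rmult_le_compat_l; [apply pow_le, Cmod_ge_0 | apply Hw].
  - now apply weighted_single_sum.
Qed.

(** Both truncations are sums over [k <= K]; on the polynomial side because the
    weights vanish for [N < k]. The difference is compared term by term in
    [k]. *)
Lemma rogers_formal (a b : list C) (q x y : C) :
  q <> 0 -> (Cmod q < 1)%R -> y <> 0 ->
  (forall (c : C) (i : nat), In c b -> c * q ^ i <> 1) ->
  rogers_formal_eq a b q x y.
Proof.
  intros Hq0 Hq Hy Hb K.
  set (D := fun k s t =>
    psi_coef a b q x y k * sum_n (fun N => y ^ N * weight q k N * qbinom_term q s t N) K
    - qpoch_inf (y * t) q / qpoch_inf (y * s) q
      * Phi_term (a ++ t / s :: nil) (b ++ q / (y * s) :: nil) q (x * q / y) k).
  assert (HD : forall k, vanishes_to_order (S K) (D k)).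
  { intros k.
    destruct (weighted_sum_remainder q y k K Hq0 Hq) as (M & delta & Hdel & H).
    exists (Cmod (psi_coef a b q x y k) * M)%R, delta. split; [exact Hdel|].
    intros s t Hs Hds Hdt. destruct (H s t Hds Hdt) as [Hsmall Hrem]. unfold D.
    rewrite <- psi_coef_weighted_value; try assumption; [|now apply qpochs_neq0].
    match goal with |- (Cmod (?u * ?v - ?u * ?w)%C <= _)%R =>
      replace (u * v - u * w) with (u * (v - w)) by ring end.
    rewrite Cmod_mult, Rmult_assoc.
    apply Rmult_le_compat_l; [apply Cmod_ge_0 | exact Hrem]. }
  destruct (vanishes_to_order_sum (S K) D K HD) as (M & delta & Hdel & H).
  exists M, delta. split; [exact Hdel|]. intros s t Hs Hds Hdt.
  specialize (H s t Hs Hds Hdt).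
  replace (rogers_trunc a b q x y s t K - product_side_trunc a b q x y s t K)
    with (sum_n (fun k => D k s t) K); [exact H|].
  unfold D, product_side_trunc.
  rewrite (sum_n_ext _ (fun k => plus
    (sum_n (fun N => psi_coef a b q x y k * (y ^ N * weight q k N * qbinom_term q s t N)) K)
    (- (qpoch_inf (y * t) q / qpoch_inf (y * s) q)
      * Phi_term (a ++ t / s :: nil) (b ++ q / (y * s) :: nil) q (x * q / y) k))).
  2: { intros k. rewrite sum_n_Cmult_l. change plus with Cplus. eqC. ring. }
  rewrite (sum_n_plus (G := C_AbelianMonoid)), sum_n_Cmult_l, sum_n_switch.
  change plus with Cplus.
  replace (rogers_trunc a b q x y s t K) with
    (sum_n (fun N => sum_n (fun k =>
       psi_coef a b q x y k * (y ^ N * weight q k N * qbinom_term q s t N)) K) K).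
  { eqC. ring. }
  apply sum_n_ext_loc. intros N HN.
  transitivity (sum_n (fun n => rogers_coef q s t n (N - n) * psi a b q x y N) N).
  - rewrite sum_n_Cmult_r, rogers_coef_antidiagonal, (psi_weight a b q x y N K), <- sum_n_Cmult_l
      by (auto; intros; lia).
    apply sum_n_ext. intros k. eqC. ring.
  - apply sum_n_ext_loc. intros n Hn. unfold rogers_term.
    now replace (n + (N - n))%nat with N by lia.
Qed.

Theorem theorem6 (r : nat) (a b : list C) (q x y : C)
  (Ha : length a = S r) (Hb : length b = r)
  (Hq0 : q <> 0) (Hq : (Cmod q < 1)%R) (Hy : y <> 0)
  (Hbq : forall (c : C) (i : nat), In c b -> c * q ^ i <> 1) :
  (forall s t : C,
     s <> 0 ->
     (Cmod (y * s) < 1)%R ->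
     (forall i : nat, q / (y * s) * q ^ i <> 1) ->
     rogers_abs_cv a b q x y s t ->
     ex_series (Phi_term (a ++ t / s :: nil) (b ++ q / (y * s) :: nil)
                  q (x * q / y)) /\
     is_series2
       (fun n m => (- (1)) ^ n * q ^ (n * (n - 1) / 2)%nat
          * psi a b q x y (n + m) * (t ^ n / qpoch q q n)
          * (s ^ m / qpoch q q m))
       (qpoch_inf (y * t) q / qpoch_inf (y * s) q
        * Phi (a ++ t / s :: nil) (b ++ q / (y * s) :: nil) q (x * q / y)))
  /\ rogers_formal_eq a b q x y.
Proof.
  split.
  - intros s t Hs _ _ Hcv. now apply rogers_analytic.
  - now apply rogers_formal.
Qed.
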